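(* Let $(M,h)$ be a Riemannian manifold and $V$, $W$ two vector fields on $M$. Consider Zermelo's navigation problem on $M$ with the following data: (I) the Riemannian metric $(M,h)$ with wind $V+W$, under the condition $\|V+W\|_h<1$; (II) the Finsler metric $(M,F_1)$ with wind $W$, under the condition $F_1(-W)<1$, where $F_1=\alpha+\beta$ is the solution of Zermelo's navigation problem for the navigation data $(M,h)$ with wind $V$, $\|V\|_h<1$. Then the Zermelo navigation problems (I) and (II) have the same solution $F=\widetilde\alpha+\widetilde\beta$ (a Randers metric).
   Context: A Randers metric is a Finsler metric of the form $\alpha+\beta$ with $\alpha(x,y)=\sqrt{a_{ij}(x)y^iy^j}$ the norm of a Riemannian metric and $\beta=b_i(x)y^i$ a 1-form with $a^{ij}b_ib_j<1$. For a Finsler metric $G$ (in particular the norm $G=\|\cdot\|_h$ of a Riemannian metric $h$) and a vector field $U$ (the wind) with $G(-U)<1$, the solution of Zermelo's navigation problem with data $(M,G)$ and wind $U$ is the Finsler metric $\widetilde G$ whose indicatrix $\{\widetilde G=1\}$ in each $T_xM$ is the translate of the indicatrix $\{G=1\}$ by $U(x)$; equivalently $G\big(\frac{y}{\widetilde G(y)}-U\big)=1$ for all $y\neq 0$. For $G=\|\cdot\|_h$ the solution is the Randers metric $\frac{\sqrt{\lambda\|y\|_h^2+h(U,y)^2}}{\lambda}-\frac{h(U,y)}{\lambda}$ with $\lambda=1-\|U\|_h^2$. *)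

(* Defs.v *)
From HB Require Import structures.
From mathcomp Require Import all_boot all_order all_algebra.
From mathcomp Require Import all_classical all_reals all_analysis.

Set Implicit Arguments.
Unset Strict Implicit.
Unset Printing Implicit Defensive.

Import Order.TTheory GRing.Theory Num.Theory.
Import numFieldNormedType.Exports.

Local Open Scope classical_set_scope.
Local Open Scope ring_scope.

(* [A] is meant to be open. Between finite-dimensional spaces, asking that each
   [x |-> 'd f x v] be C^k is the same as asking that ['d f] be C^k. *)
Fixpoint Ck_on (R : realType) (U V : normedModType R) (k : nat)
    (A : set U) (f : U -> V) : Prop :=
  match k with
  | 0 => forall x, A x -> {for x, continuous f}
  | k'.+1 => (forall x, A x -> differentiable f x) /\
             (forall v, Ck_on k' A (fun x => 'd f x v))
  end.

Definition smooth_on (R : realType) (U V : normedModType R)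
    (A : set U) (f : U -> V) : Prop :=
  forall k, Ck_on k A f.

(* The chart [i] is the homeomorphism [chart i] from [chart_dom i] onto an open
   subset of R^n, with inverse [chart_inv i]; the values of these total
   functions outside the two open sets are irrelevant. [chart_at x] is a choice
   of a chart around [x], used only to give a concrete model of T_x M. *)
Record smooth_manifold (R : realType) (n : nat) := SmoothManifold {
  carrier :> topologicalType;
  manifold_hausdorff : hausdorff_space carrier;
  manifold_second_countable : @second_countable carrier;
  atlas : Type;
  chart_dom : atlas -> set carrier;
  chart : atlas -> carrier -> 'rV[R]_n;
  chart_inv : atlas -> 'rV[R]_n -> carrier;
  chart_at : carrier -> atlas;
  chart_dom_open : forall i, open (chart_dom i);
  chart_img_open : forall i, open (chart i @` chart_dom i);
  chartK : forall i x, chart_dom i x -> chart_inv i (chart i x) = x;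
  chart_continuous : forall i x, chart_dom i x -> {for x, continuous (chart i)};
  chart_inv_continuous : forall i u, (chart i @` chart_dom i) u ->
    {for u, continuous (chart_inv i)};
  chart_atP : forall x, chart_dom (chart_at x) x;
  transition_smooth : forall i j,
    smooth_on (chart i @` (chart_dom i `&` chart_dom j))
              (chart j \o chart_inv i)
}.

Definition chart_img (R : realType) (n : nat) (M : smooth_manifold R n)
    (i : atlas M) : set 'rV[R]_n :=
  chart i @` chart_dom i.

(* T_x M, a vector being represented by its components in [chart_at x]. *)
Definition tangent (R : realType) (n : nat) (M : smooth_manifold R n)
    (x : M) : normedModType R :=
  'rV[R]_n.

(* The tangent vector at the point of coordinates [u] in the chart [i] whose
   components in the chart [i] are [w]. *)
Definition of_coord (R : realType) (n : nat) (M : smooth_manifold R n)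
    (i : atlas M) (u w : 'rV[R]_n) : tangent (chart_inv i u) :=
  'd (chart (chart_at (chart_inv i u)) \o chart_inv i) u w.

(* The components in the chart [i] of a tangent vector at the point of
   coordinates [u] in that chart. *)
Definition to_coord (R : realType) (n : nat) (M : smooth_manifold R n)
    (i : atlas M) (u : 'rV[R]_n) (v : tangent (chart_inv i u)) : 'rV[R]_n :=
  let c := chart_at (chart_inv i u) in
  'd (chart i \o chart_inv c) (chart c (chart_inv i u)) v.

Record vector_field (R : realType) (n : nat) (M : smooth_manifold R n) :=
  VectorField {
  vf_fun :> forall x : M, tangent x;
  vf_smooth : forall i : atlas M,
    smooth_on (chart_img i) (fun u => to_coord (vf_fun (chart_inv i u)))
}.

Record one_form (R : realType) (n : nat) (M : smooth_manifold R n) := OneForm {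
  of_fun :> forall x : M, tangent x -> R;
  of_linear : forall x : M, scalar (@of_fun x);
  of_smooth : forall (i : atlas M) (w : 'rV[R]_n),
    smooth_on (chart_img i)
      (fun u => of_fun (of_coord i u w) : R^o)
}.

Record riemannian_metric (R : realType) (n : nat) (M : smooth_manifold R n) :=
  RiemannianMetric {
  rm_fun :> forall x : M, tangent x -> tangent x -> R;
  rm_linear : forall (x : M) (w : tangent x), scalar (@rm_fun x ^~ w);
  rm_sym : forall (x : M) (v w : tangent x), rm_fun v w = rm_fun w v;
  rm_pos : forall (x : M) (v : tangent x), v != 0 -> 0 < rm_fun v v;
  rm_smooth : forall (i : atlas M) (w w' : 'rV[R]_n),
    smooth_on (chart_img i)
      (fun u => rm_fun (of_coord i u w) (of_coord i u w') : R^o)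
}.

Definition rnorm (R : realType) (n : nat) (M : smooth_manifold R n)
    (h : riemannian_metric M) (x : M) (y : tangent x) : R :=
  Num.sqrt (h x y y).

(* a^{ij} b_i b_j, in the coordinates given by [chart_at x]. *)
Definition dual_norm_sq (R : realType) (n : nat) (M : smooth_manifold R n)
    (a : riemannian_metric M) (b : one_form M) (x : M) : R :=
  let e : 'I_n -> tangent x := fun i => delta_mx 0 i in
  let A : 'M[R]_n := \matrix_(i, j) a x (e i) (e j) in
  \sum_i \sum_j invmx A i j * b x (e i) * b x (e j).

(* g_y(v, w) = 1/2 * (d^2 F^2 / dy^i dy^j)(y) v^i w^j *)
Definition fundamental_tensor (R : realType) (n : nat)
    (M : smooth_manifold R n) (F : forall x : M, tangent x -> R)
    (x : M) (y v w : tangent x) : R :=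
  2^-1 * 'D_v (fun z : tangent x =>
                 'D_w (fun z' : tangent x => F x z' ^+ 2 : R^o) z : R^o) y.

Record is_finsler (R : realType) (n : nat) (M : smooth_manifold R n)
    (F : forall x : M, tangent x -> R) : Prop := IsFinsler {
  finsler_smooth : forall i : atlas M,
    smooth_on [set p : 'rV[R]_n * 'rV[R]_n | chart_img i p.1 /\ p.2 != 0]
              (fun p => F _ (of_coord i p.1 p.2) : R^o);
  finsler_pos : forall (x : M) (y : tangent x), y != 0 -> 0 < F x y;
  finsler_homogeneous : forall (x : M) (t : R) (y : tangent x),
    0 < t -> F x (t *: y) = t * F x y;
  finsler_convex : forall (x : M) (y v : tangent x),
    y != 0 -> v != 0 -> 0 < fundamental_tensor F y v v
}.

Definition is_randers (R : realType) (n : nat) (M : smooth_manifold R n)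
    (F : forall x : M, tangent x -> R) : Prop :=
  is_finsler F /\
  exists (a : riemannian_metric M) (b : one_form M),
    (forall x : M, dual_norm_sq a b x < 1) /\
    (forall (x : M) (y : tangent x), F x y = rnorm a y + b x y).

Definition indicatrix (R : realType) (n : nat) (M : smooth_manifold R n)
    (F : forall x : M, tangent x -> R) (x : M) : set (tangent x) :=
  [set y | F x y = 1].
Arguments indicatrix {R n M} F x.

(* The standing condition [G x (- U x) < 1] on the data is not included. *)
Definition zermelo_solution (R : realType) (n : nat) (M : smooth_manifold R n)
    (G : forall x : M, tangent x -> R) (U : forall x : M, tangent x)
    (Gt : forall x : M, tangent x -> R) : Prop :=
  is_finsler Gt /\
  forall x : M, indicatrix Gt x = [set z + U x | z in indicatrix G x].

(* Main.v *)
Require Import Defs.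
From HB Require Import structures.
From mathcomp Require Import all_boot all_order all_algebra.
From mathcomp Require Import all_classical all_reals all_analysis.
From mathcomp Require Import ring lra.
Import Order.TTheory GRing.Theory Num.Theory.
Import numFieldNormedType.Exports.
Local Open Scope classical_set_scope.
Local Open Scope ring_scope.

(* A solution of Zermelo's problem is determined by its indicatrix, and both
   problems prescribe the same one: translating the indicatrix of h by V and
   then by W is translating it by V + W. So it suffices to solve the problem for
   h and one wind U with |U| < 1. Squaring shows that the Randers metric with
     a(v, w) = (lam h(v, w) + h(U, v) h(U, w)) / lam^2,  b(v) = - h(U, v) / lam,
   where lam = 1 - |U|^2, has the translated unit sphere of h as indicatrix. *)

(** * Calculus of [Ck_on] functions on open sets of normed spaces *)

Section CkCalculus.
Context {R : realType}.
Implicit Types U V W : normedModType R.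

(** Differentiability is local: the first-order expansion of [f] at [x] is also one of [g], and such
    an expansion determines the differential. *)
Lemma near_eq_is_diff {U V} (f g df : U -> V) (x : U) :
  (\forall z \near x, f z = g z) -> is_diff x f df -> is_diff x g df.
Proof.
move=> fg [fx <-].
have fgx : f x = g x by exact: nbhs_singleton fg.
have gE : g \o shift x = cst (g x) + 'd f x +o_ 0 id.
  have := diff_locally fx; rewrite -fgx => /eqaddoP fo.
  apply/eqaddoP => e e0; move: fg (fo e e0); rewrite (near_shift 0).
  by apply: filterS2 => /= z; rewrite !fctE /= subr0 => ->.
have gu := diff_unique (diff_continuous fx) gE.
split; last by rewrite gu.
by apply/diff_locallyP; rewrite gu; split => //; exact: diff_continuous.
Qed.

(** Since [A] is open, [f] and [g] agree near each of its points, so their differentials agree on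
    [A] and the induction goes on with these. *)
Lemma Ck_on_ext {U V} {k : nat} {A : set U} (f : U -> V) {g : U -> V} :
  open A -> (forall x, A x -> f x = g x) -> Ck_on k A f -> Ck_on k A g.
Proof.
move=> oA; elim: k f g => [|k IH] f g fg /=.
  move=> fc x Ax; have := fc x Ax; rewrite /prop_for /continuous_at -fg//.
  apply: cvg_trans; apply: near_eq_cvg.
  by apply: filterS (open_nbhs_nbhs (conj oA Ax)) => z Az; rewrite fg.
move=> [fd fD].
have gd x : A x -> is_diff x g ('d f x).
  move=> Ax; apply: near_eq_is_diff (differentiableP (fd x Ax)).
  by apply: filterS (open_nbhs_nbhs (conj oA Ax)) => z Az; rewrite fg.
split=> [x Ax|v]; first by have [] := gd x Ax.
by apply: IH (fD v) => x Ax; have [_ ->] := gd x Ax.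
Qed.

(** Lets an explicit formula [df] stand for ['d f], with which it agrees on [A] only; [Ck_on_ext]
    absorbs the difference. The inductions on [k] below use it to apply differentiation rules. *)
Lemma Ck_onS {U V} {k : nat} {A : set U} {f : U -> V} (df : U -> U -> V) :
  open A -> (forall x, A x -> is_diff x f (df x)) ->
  (forall v, Ck_on k A (df ^~ v)) -> Ck_on k.+1 A f.
Proof.
move=> oA fd dfk; split=> [x Ax|v]; first by have [] := fd x Ax.
by apply: Ck_on_ext (dfk v) => // x Ax; have [_ ->] := fd x Ax.
Qed.

Lemma Ck_onW {U V} {k : nat} {A : set U} {f : U -> V} :
  Ck_on k.+1 A f -> Ck_on k A f.
Proof.
elim: k f => [|k IH] f [fd fD]; last by split=> // v; exact/IH.
by move=> x Ax; exact/differentiable_continuous/fd.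
Qed.

Lemma Ck_on_cst {U V} {k : nat} {A : set U} (c : V) :
  open A -> Ck_on k A (fun=> c).
Proof.
move=> oA; elim: k c => [|k IH] c; first by move=> x _; exact: cvg_cst.
exact: (Ck_onS (fun=> 0)).
Qed.

(** The derivative of [f \o L] along [v] is the derivative of [f] along [L v], again precomposed
    with [L], so the induction closes. *)
Lemma Ck_on_precomp_linear {U U' V} {L : U' -> U} {k : nat} {A : set U}
    {f : U -> V} :
  (forall x, is_diff x L L) -> open A ->
  Ck_on k A f -> Ck_on k (L @^-1` A) (f \o L).
Proof.
move=> Ld oA.
have Lc : continuous L by move=> x; exact: differentiable_continuous.
elim: k f => [|k IH] f /=.
  by move=> fc x Ax; apply: continuous_comp; [exact: Lc|exact: fc].
move=> [fd fD]; apply: (Ck_onS (fun x => 'd f (L x) \o L)).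
- by apply: open_comp => // x _; exact: Lc.
- move=> x Ax; apply: is_diff_comp; exact: differentiableP (fd _ Ax).
- by move=> v; exact: (IH (fun x => 'd f x (L v))).
Qed.

Lemma Ck_on_postcomp_linear {U V W} {L : V -> W} {k : nat} {A : set U}
    {f : U -> V} :
  (forall x, is_diff x L L) -> open A -> Ck_on k A f -> Ck_on k A (L \o f).
Proof.
move=> Ld oA; elim: k f => [|k IH] f /=.
  move=> fc x Ax; apply: continuous_comp; first exact: fc.
  exact: differentiable_continuous.
move=> [fd fD]; apply: (Ck_onS (fun x => L \o 'd f x)) => //.
- by move=> x Ax; apply: is_diff_comp; exact: differentiableP (fd _ Ax).
- by move=> v; exact: (IH (fun x => 'd f x v)).
Qed.

Lemma Ck_onD {U V} {k : nat} {A : set U} {f g : U -> V} :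
  open A -> Ck_on k A f -> Ck_on k A g -> Ck_on k A (fun x => f x + g x).
Proof.
move=> oA; elim: k f g => [|k IH] f g.
  by move=> fc gc x Ax; apply: continuousD; [exact: fc|exact: gc].
move=> [fd fD] [gd gD]; apply: (Ck_onS (fun x v => 'd f x v + 'd g x v)) => //.
- move=> x Ax; have := fd x Ax; have := gd x Ax.
  by move=> /differentiableP ? /differentiableP ?; exact: is_diffD.
- by move=> v; exact: (IH _ _ (fD v) (gD v)).
Qed.

Lemma Ck_onM {U} {k : nat} {A : set U} {f g : U -> R^o} :
  open A -> Ck_on k A f -> Ck_on k A g ->
  Ck_on k A (fun x => f x * g x : R^o).
Proof.
move=> oA; elim: k f g => [|k IH] f g.
  by move=> fc gc x Ax; apply: continuousM; [exact: fc|exact: gc].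
move=> fk gk; have [fd fD] := fk; have [gd gD] := gk.
apply: (Ck_onS (fun x v => f x * 'd g x v + g x * 'd f x v)) => //.
- move=> x Ax; have := fd x Ax; have := gd x Ax.
  move=> /differentiableP dg /differentiableP df.
  exact: is_diffM.
- by move=> v /=; apply: Ck_onD => //;
    [exact: IH (Ck_onW fk) (gD v)|exact: IH (Ck_onW gk) (fD v)].
Qed.

Lemma Ck_onN {U} {k : nat} {A : set U} {f : U -> R^o} :
  open A -> Ck_on k A f -> Ck_on k A (fun x => - f x : R^o).
Proof.
move=> oA fk; apply: (@Ck_on_ext _ _ _ _ (fun x => -1 * f x)) => //.
  by move=> x _; rewrite mulN1r.
by apply: Ck_onM => //; exact: Ck_on_cst.
Qed.

(** Regularity of [dphi \o f] is left as a premise so that a [phi] whose derivative is expressed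
    through [phi] itself, such as the inverse or the square root, can be treated by induction on
    [k]. *)
Lemma Ck_on_comp1 {U} {k : nat} {A : set U} (phi dphi : R -> R) {f : U -> R^o} :
  open A -> (forall x, A x -> is_derive (f x : R^o) 1 phi (dphi (f x))) ->
  Ck_on k A (dphi \o f : U -> R^o) ->
  Ck_on k.+1 A f -> Ck_on k.+1 A (phi \o f : U -> R^o).
Proof.
move=> oA phid dphik fk; have [fd fD] := fk.
apply: (Ck_onS (fun x v => dphi (f x) * 'd f x v)) => //.
- move=> x Ax; have fx := differentiableP (fd x Ax).
  have [phidx <-] := phid x Ax.
  have /derivable1_diffP dphi_x := phidx.
  apply: is_diff_eq.
    apply: is_diff_comp; exact: differentiableP.
  rewrite deriv1E // funeqE => v /=.
  by rewrite derive1E mulrC.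
- by move=> v; exact: (Ck_onM oA dphik (fD v)).
Qed.

Lemma is_derive1_inv (x : R) :
  x != 0 -> is_derive (x : R^o) 1 GRing.inv (- (x^-1 * x^-1)).
Proof.
move=> x0; apply: DeriveDef; first exact: derivableV.
by rewrite deriveV // derive_id /GRing.scale /= mulr1 expr2 invfM.
Qed.

Lemma Ck_onV {U} {k : nat} {A : set U} {f : U -> R^o} :
  open A -> (forall x, A x -> f x != 0) ->
  Ck_on k A f -> Ck_on k A (fun x => (f x)^-1 : R^o).
Proof.
move=> oA f0; elim: k => [|k IH] fk.
  by move=> x Ax; apply: continuousV; [exact: f0|exact: fk].
(* The derivative is a polynomial in the inverse, which is C^k by induction. *)
apply: (Ck_on_comp1 (@GRing.inv R) (fun r => - (r^-1 * r^-1))) => //.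
- by move=> x Ax; exact/is_derive1_inv/f0.
- by apply: Ck_onN => //; apply: Ck_onM => //; apply/IH/Ck_onW.
Qed.

Lemma Ck_on_sqrt {U} {k : nat} {A : set U} {f : U -> R^o} :
  open A -> (forall x, A x -> 0 < f x) ->
  Ck_on k A f -> Ck_on k A (fun x => Num.sqrt (f x) : R^o).
Proof.
move=> oA f0; elim: k => [|k IH] fk.
  move=> x Ax; apply: (@continuous_comp _ _ _ f (@Num.sqrt R)); first exact: fk.
  exact: sqrt_continuous.
(* The derivative is the inverse of a multiple of the root itself; positivity of [f] keeps it away
   from the singular point 0. *)
apply: (Ck_on_comp1 (@Num.sqrt R) (fun r => (2 * Num.sqrt r)^-1)) => //.
- by move=> x Ax; exact/is_derive1_sqrt/f0.
- apply: Ck_onV => // [x Ax|].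
    by rewrite mulf_neq0 // gt_eqF // sqrtr_gt0 f0.
  by apply: Ck_onM => //; [exact: Ck_on_cst|apply/IH/Ck_onW].
Qed.

Lemma Ck_on_sum {U V} {k : nat} {A : set U} {I : Type} (r : seq I)
    (f : I -> U -> V) :
  open A -> (forall i, Ck_on k A (f i)) ->
  Ck_on k A (fun x => \sum_(i <- r) f i x).
Proof.
move=> oA fk; elim: r => [|i r IH].
  by apply: (Ck_on_ext (fun=> 0)) (Ck_on_cst _ _) => // x _; rewrite big_nil.
apply: (Ck_on_ext (fun x => f i x + \sum_(j <- r) f j x)) (Ck_onD _ _ _) => //.
by move=> x _; rewrite big_cons.
Qed.

Lemma is_diff_linear {U V} {f : U -> V} (x : U) :
  linear f -> continuous f -> is_diff x f f.
Proof.
move=> fL fc; pose fM := GRing.isLinear.Build _ _ _ _ _ fL.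
pose fl : {linear U -> V} := HB.pack f fM.
split; first exact: (@linear_differentiable _ _ _ fl).
by rewrite [LHS](@diff_lin _ _ _ fl).
Qed.

Lemma is_diff_coord {m n : nat} (i : 'I_m) (j : 'I_n) (M : 'M[R]_(m, n)) :
  is_diff M (fun N : 'M[R]_(m, n) => N i j : R^o) (fun N => N i j).
Proof.
by apply: is_diff_linear; [move=> a A B; rewrite !mxE|exact: coord_continuous].
Qed.

Lemma is_diff_fst {U V} (p : U * V) : is_diff p (@fst U V) (@fst U V).
Proof.
by apply: is_diff_linear; [move=> a [? ?] [? ?]|move=> x; exact: cvg_fst].
Qed.

Lemma is_diff_snd {U V} (p : U * V) : is_diff p (@snd U V) (@snd U V).
Proof.
by apply: is_diff_linear; [move=> a [? ?] [? ?]|move=> x; exact: cvg_snd].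
Qed.

Lemma Ck_on_subset {U V} {k : nat} {A B : set U} {f : U -> V} :
  A `<=` B -> Ck_on k B f -> Ck_on k A f.
Proof.
move=> AB; elim: k f => [|k IH] f; first by move=> fc x /AB; exact: fc.
by move=> [fd fD]; split=> [x /AB|v]; [exact: fd|exact: IH (fD v)].
Qed.

End CkCalculus.

(** * Coordinate changes, and smoothness of tensors evaluated on varying vectors *)

Section Charts.
Context {R : realType} {n : nat} {M : smooth_manifold R n}.
Implicit Types (i j : atlas M) (h : riemannian_metric M) (b : one_form M).

Lemma open_chart_img i : open (chart_img i).
Proof. exact: chart_img_open. Qed.

(** Chain rule: the two transition maps compose to the identity near [chart j x], so their
    differentials compose to the identity. *)
Lemma transition_diffK i j (x : M) (v : 'rV[R]_n) :
  chart_dom i x -> chart_dom j x ->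
  ('d (chart j \o chart_inv i) (chart i x) \o
    'd (chart i \o chart_inv j) (chart j x)) v = v.
Proof.
move=> xi xj.
have ijd : differentiable (chart j \o chart_inv i) (chart i x).
  by have [+ _] := transition_smooth i j 1%N; apply; exists x.
have jid : differentiable (chart i \o chart_inv j) (chart j x).
  by have [+ _] := transition_smooth j i 1%N; apply; exists x.
have xE : (chart i \o chart_inv j) (chart j x) = chart i x by rewrite /= chartK.
have gd : is_diff ((chart i \o chart_inv j) (chart j x))
    (chart j \o chart_inv i) ('d (chart j \o chart_inv i) (chart i x)).
  by rewrite xE; exact: differentiableP.
have [_ <-] := is_diff_comp (differentiableP jid) gd.
suff fg : \forall w \near chart j x,
    id w = ((chart j \o chart_inv i) \o (chart i \o chart_inv j)) w.
  by have [_ ->] := near_eq_is_diff _ _ _ _ fg (is_diff_id _).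
(* Points near [chart j x] come from both chart domains: from that of [i] by continuity of
   [chart_inv j], from that of [j] because chart images are open. *)
have wi : \forall w \near chart j x, chart_dom i (chart_inv j w).
  apply: (chart_inv_continuous (i := j) (u := chart j x)); first by exists x.
  by rewrite chartK //; apply: open_nbhs_nbhs; split=> //; exact: chart_dom_open.
have wj : \forall w \near chart j x, chart_img j w.
  by apply: open_nbhs_nbhs; split; [exact: open_chart_img|exists x].
apply: filterS2 wi wj => w wi [z zj zw].
by rewrite -zw chartK// in wi; rewrite -zw /= chartK// chartK.
Qed.

Lemma to_coordK i (u : 'rV[R]_n) (v : tangent (chart_inv i u)) :
  chart_img i u -> of_coord i u (to_coord v) = v.
Proof.
move=> [x xi xu]; rewrite /of_coord /to_coord.
(* The type of [v] mentions the base point, so [v] is generalized before the base point is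
   rewritten. *)
move: v; rewrite -xu chartK// => v.
exact/transition_diffK/chart_atP.
Qed.

Lemma of_coordK i (u w : 'rV[R]_n) :
  chart_img i u -> to_coord (of_coord i u w) = w.
Proof.
move=> [x xi xu]; rewrite /of_coord /to_coord -xu chartK//.
by apply: transition_diffK => //; exact: chart_atP.
Qed.

Lemma of_coord_eq0 i (u w : 'rV[R]_n) :
  chart_img i u -> (of_coord i u w == 0) = (w == 0).
Proof.
move=> ui; apply/eqP/eqP => [w0|->]; last exact: linear0.
by rewrite -(of_coordK i u w ui) w0 /to_coord linear0.
Qed.

Lemma rmC h (x : M) (v w : tangent x) : h x v w = h x w v.
Proof. exact: rm_sym. Qed.

Lemma rmDl h (x : M) (v v' w : tangent x) : h x (v + v') w = h x v w + h x v' w.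
Proof. by have := @rm_linear _ _ _ h x w 1 v v'; rewrite scale1r mul1r. Qed.

Lemma rm0l h (x : M) (w : tangent x) : h x 0 w = 0.
Proof. by have := rmDl h x 0 0 w; rewrite addr0 -[LHS]addr0 => /addrI. Qed.

Lemma rmZl h (x : M) (c : R) (v w : tangent x) : h x (c *: v) w = c * h x v w.
Proof. by have := @rm_linear _ _ _ h x w c v 0; rewrite addr0 rm0l addr0. Qed.

Lemma rmDr h (x : M) (v w w' : tangent x) : h x v (w + w') = h x v w + h x v w'.
Proof. by rewrite rmC rmDl !(rmC _ _ v). Qed.

Lemma rmZr h (x : M) (c : R) (v w : tangent x) : h x v (c *: w) = c * h x v w.
Proof. by rewrite rmC rmZl rmC. Qed.

Lemma rm_ge0 h (x : M) (v : tangent x) : 0 <= h x v v.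
Proof. by have [->|/(rm_pos h)/ltW//] := eqVneq v 0; rewrite rm0l. Qed.

Lemma rm_suml h (x : M) (I : Type) (r : seq I) (f : I -> tangent x) w :
  h x (\sum_(k <- r) f k) w = \sum_(k <- r) h x (f k) w.
Proof.
by apply: (big_morph ((h x)^~ w)); [move=> ? ?; exact: rmDl|exact: rm0l].
Qed.

Lemma one_form0 b (x : M) : b x 0 = 0.
Proof.
have := @of_linear _ _ _ b x 1 0 0.
by rewrite scaler0 addr0 mul1r -[LHS]addr0 => /addrI.
Qed.

Lemma one_formD b (x : M) (v w : tangent x) : b x (v + w) = b x v + b x w.
Proof. by have := @of_linear _ _ _ b x 1 v w; rewrite scale1r mul1r. Qed.

Lemma one_formZ b (x : M) (c : R) (v : tangent x) : b x (c *: v) = c * b x v.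
Proof.
by have := @of_linear _ _ _ b x c v 0; rewrite addr0 one_form0 addr0.
Qed.

Lemma one_form_sum b (x : M) (I : Type) (r : seq I) (f : I -> tangent x) :
  b x (\sum_(k <- r) f k) = \sum_(k <- r) b x (f k).
Proof. by apply: (big_morph (b x)); [exact: one_formD|exact: one_form0]. Qed.

(** The smoothness field of [b] only concerns constant components, so [f x] is expanded in the
    standard basis. The map [p] selects the base point; it will be the first projection of pairs. *)
Lemma Ck_on_one_form b i {U : normedModType R} {k : nat} {A : set U}
    (p f : U -> 'rV[R]_n) :
  (forall x, is_diff x p p) -> open A -> A `<=` p @^-1` chart_img i ->
  Ck_on k A f -> Ck_on k A (fun x => b _ (of_coord i (p x) (f x)) : R^o).
Proof.
move=> pd oA Ap fk.
apply: (Ck_on_ext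
  (fun x => \sum_j f x 0 j * b _ (of_coord i (p x) 'e_j))) => //.
  move=> x Ax.
  rewrite [in RHS](row_sum_delta (f x)) /of_coord linear_sum one_form_sum.
  by apply: eq_bigr => j _; rewrite linearZ one_formZ.
apply: Ck_on_sum => // j; apply: Ck_onM => //.
  exact: (Ck_on_postcomp_linear (is_diff_coord 0 j)).
apply: (Ck_on_subset Ap).
apply: (Ck_on_precomp_linear
  (f := fun u => b _ (of_coord i u 'e_j) : R^o)) => //.
  exact: open_chart_img.
exact: of_smooth.
Qed.

(** Same basis expansion, in both arguments; [p] will be a projection or the identity. *)
Lemma Ck_on_metric h i {U : normedModType R} {k : nat} {A : set U}
    (p f g : U -> 'rV[R]_n) :
  (forall x, is_diff x p p) -> open A -> A `<=` p @^-1` chart_img i ->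
  Ck_on k A f -> Ck_on k A g ->
  Ck_on k A
    (fun x => h _ (of_coord i (p x) (f x)) (of_coord i (p x) (g x)) : R^o).
Proof.
move=> pd oA Ap fk gk.
apply: (Ck_on_ext (fun x => \sum_j \sum_l f x 0 j * g x 0 l *
    h _ (of_coord i (p x) 'e_j) (of_coord i (p x) 'e_l))) => //.
  move=> x Ax.
  rewrite [in RHS](row_sum_delta (f x)) /of_coord linear_sum rm_suml.
  apply: eq_bigr => j _; rewrite linearZ rmZl rmC.
  rewrite [in RHS](row_sum_delta (g x)) linear_sum rm_suml mulr_sumr.
  by apply: eq_bigr => l _; rewrite linearZ rmZl rmC mulrA.
apply: Ck_on_sum => // j; apply: Ck_on_sum => // l.
apply: Ck_onM => //; first apply: Ck_onM => //.
- exact: (Ck_on_postcomp_linear (is_diff_coord 0 j)).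
- exact: (Ck_on_postcomp_linear (is_diff_coord 0 l)).
apply: (Ck_on_subset Ap).
apply: (Ck_on_precomp_linear
  (f := fun u => h _ (of_coord i u 'e_j) (of_coord i u 'e_l) : R^o)) => //.
  exact: open_chart_img.
exact: rm_smooth.
Qed.

End Charts.

(** * Directional derivatives computed along lines *)

Section DirectionalDerivatives.
Context {R : realType} {U : normedModType R}.

(** Both sides have the same difference quotient; this gives access to the one-variable rules. *)
Lemma is_derive_lineP (f : U -> R^o) (x v : U) (df : R) :
  is_derive x v f df <->
  is_derive (0 : R^o) 1 (fun t : R^o => f (t *: v + x) : R^o) df.
Proof.
suff fE : 'D_v f x = 'D_1 (fun t : R^o => f (t *: v + x) : R^o) 0.
  have fP := derivable1P f x v.
  by split=> -[/fP fd <-]; apply: DeriveDef; rewrite ?fE//; exact/fP.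
rewrite /derive; set g1 := fun t => t^-1 *: _; set g2 := fun t => t^-1 *: _.
suff -> : g1 = g2 by [].
by rewrite funeqE /g1 /g2 => t /=; rewrite addr0 scale0r add0r [_%:A]mulr1.
Qed.

Lemma is_derive_comp1 (phi : R -> R) (f : U -> R^o) (x v : U) (dphi df : R) :
  is_derive (f x : R^o) 1 phi dphi -> is_derive x v f df ->
  is_derive x v (phi \o f : U -> R^o) (dphi * df).
Proof.
move=> phid /is_derive_lineP fd; apply/is_derive_lineP.
apply: (is_derive1_comp (f := phi) (g := fun t => f (t *: v + x))) => //.
by rewrite scale0r add0r.
Qed.

Lemma is_derive_scalar (f : U -> R^o) (x v : U) :
  scalar f -> is_derive x v f (f v).
Proof.
move=> fl; apply/is_derive_lineP.
rewrite (_ : (fun t => _) = (fun t => t * f v + f x)); last first.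
  by apply/funext => t; rewrite fl.
apply: is_derive_eq.
by rewrite addr0 scaler0 add0r [LHS]mulr1.
Qed.

Lemma open_neq0 : open [set z : U | z != 0].
Proof.
rewrite (_ : mkset _ = ~` [set 0]); last by apply/seteqP; split=> z /eqP.
exact/closed_openC/accessible_closed_set1/hausdorff_accessible/norm_hausdorff.
Qed.

End DirectionalDerivatives.

(** * A Randers metric is a Finsler metric *)

Section RandersMetrics.
Context {R : realType} {n : nat} {M : smooth_manifold R n}.
Variables (a : riemannian_metric M) (b : one_form M).

(** The quantity is the squared norm of the component of [v] orthogonal to [y]. The equality case is
    what strict convexity needs. *)
Lemma rm_ge0_orthogonal (x : M) (y v : tangent x) :
  y != 0 -> 0 <= a x v v - a x y v ^+ 2 / a x y y
    ?= iff (v == (a x y v / a x y y) *: y).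
Proof.
move=> y0; have ayy := rm_pos a y0; set t := a x y v / a x y y.
have -> : a x v v - a x y v ^+ 2 / a x y y = a x (v - t *: y) (v - t *: y).
  rewrite -(scaleNr t y) !(rmDl, rmDr) !(rmZl, rmZr) (rmC _ _ v y) /t; field.
  by rewrite gt_eqF.
split; first exact: rm_ge0.
rewrite -[in RHS]subr_eq0; apply/eqP/eqP => [/esym|->]; last by rewrite rm0l.
by have [//|/(rm_pos a) + r0] := eqVneq (v - t *: y) 0; rewrite r0 ltxx.
Qed.

Lemma cauchy_schwarz (x : M) (v w : tangent x) :
  a x v w ^+ 2 <= a x v v * a x w w.
Proof.
have [->|v0] := eqVneq v 0; first by rewrite !rm0l expr2 !mul0r.
have [+ _] := rm_ge0_orthogonal x v w v0.
by rewrite subr_ge0 ler_pdivrMr ?rm_pos// mulrC.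
Qed.

Lemma is_derive_rm_diag (x : M) (z v : tangent x) :
  is_derive z v (fun z' => a x z' z' : R^o) (2 * a x z v).
Proof.
apply/is_derive_lineP.
(* Along the line the squared norm is a quadratic polynomial in [t]. *)
rewrite (_ : (fun t => _) =
    (fun t => t ^+ 2 * a x v v + t * (2 * a x z v) + a x z z)); last first.
  apply/funext => t; rewrite !(rmDl, rmDr) !(rmZl, rmZr) (rmC _ _ v z); ring.
apply: is_derive_eq.
rewrite /GRing.scale /=; ring.
Qed.

Lemma is_derive_rnorm (x : M) (z v : tangent x) :
  z != 0 -> is_derive z v (fun z' => rnorm a z' : R^o) (a x z v / rnorm a z).
Proof.
move=> z0; have azz := rm_pos a z0.
apply: is_derive_eq.
  apply: (is_derive_comp1 (@Num.sqrt R)) (is_derive_rm_diag x z v).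
  exact: is_derive1_sqrt.
have s0 : Num.sqrt (a x z z) != 0 by rewrite gt_eqF// sqrtr_gt0.
by rewrite /rnorm; field.
Qed.

Hypothesis one_form_lt : forall (x : M) (y : tangent x),
  y != 0 -> b x y ^+ 2 < a x y y.

Let F (x : M) (y : tangent x) : R := rnorm a y + b x y.

Lemma randers_gt0 (x : M) (y : tangent x) : y != 0 -> 0 < F x y.
Proof.
move=> y0; rewrite /F /rnorm -ltrBlDr sub0r.
apply: le_lt_trans (ler_norm _) _; rewrite normrN -sqrtr_sqr.
by rewrite ltr_sqrt ?one_form_lt// rm_pos.
Qed.

Lemma is_derive_randers (x : M) (z v : tangent x) :
  z != 0 ->
  is_derive z v (F x : tangent x -> R^o) (a x z v / rnorm a z + b x v).
Proof.
move=> z0; apply: is_deriveD; first exact: is_derive_rnorm.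
by apply: is_derive_scalar; exact: of_linear.
Qed.

(* For [F = alpha + b], [g_y(v, v) = dF(v)^2 + F(y) d^2F(v, v)], and only [alpha]
   contributes to [d^2F]. The second term vanishes only for [v] parallel to [y],
   where the first one does not. *)
Lemma randers_fundamental_tensor (x : M) (y v : tangent x) : y != 0 ->
  fundamental_tensor F y v v = (a x y v / rnorm a y + b x v) ^+ 2 +
    F x y / rnorm a y * (a x v v - a x y v ^+ 2 / a x y y).
Proof.
move=> y0; rewrite /fundamental_tensor.
(* The inner derivative is computed only for [z != 0], which is enough since the outer one depends
   only on [z] near [y]. *)
have -> : 'D_v (fun z => 'D_v (fun z' => F x z' ^+ 2 : R^o) z : R^o) y =
    'D_v (fun z => 2 * F x z * (a x z v / rnorm a z + b x v) : R^o) y.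
  apply: near_eq_derive.
  have ny : \forall z \near y, z != 0.
    apply: open_nbhs_nbhs; split=> //.
    exact: open_neq0.
  apply: filterS ny => z z0; apply: derive_val.
  rewrite (_ : (fun _ => _) = (F x : tangent x -> R) ^+ 2); last first.
    by apply/funext => z'; rewrite exprfctE.
  apply: is_derive_eq (is_deriveX 2 (is_derive_randers x z v z0)) _.
  by rewrite expr1.
set D := (X in 2^-1 * X); set X := RHS.
suff -> : D = 2 * X by rewrite mulKf.
have ayy : a x y y = rnorm a y ^+ 2 by rewrite sqr_sqrtr// ltW ?rm_pos.
have r0 : rnorm a y != 0 by rewrite gt_eqF// sqrtr_gt0 rm_pos.
have dF := is_derive_randers x y v y0.
have dr := is_derive_comp1 _ _ _ _ _ _ (is_derive1_inv _ r0)
  (is_derive_rnorm x y v y0).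
have da := is_derive_scalar ((a x)^~ v) y v (rm_linear a v).
have dadr := is_deriveD (is_deriveM da dr) (is_derive_cst (b x v : R^o) y v).
have := is_deriveZ 2 (is_deriveM dF dadr).
set G := (X in is_derive _ _ X _) => dG.
have -> : D = 'D_v G y.
  by congr ('D_v _ y); apply/funext => z; rewrite -mulrA.
apply: derive_val; apply: is_derive_eq dG _.
rewrite /X !fctE /GRing.scale /= ayy /F; field.
exact: r0.
Qed.

Lemma randers_finsler : is_finsler F.
Proof.
split.
- move=> i k.
  pose A := [set p : 'rV[R]_n * 'rV[R]_n | chart_img i p.1 /\ p.2 != 0].
  have oA : open A.
    apply: openI.
      by apply: open_comp (open_chart_img i) => p _; exact: cvg_fst.
    by apply: open_comp open_neq0 => p _; exact: cvg_snd.
  have sndk : Ck_on k A snd.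
    case: {+}k => [|j]; first by move=> p _; exact: cvg_snd.
    apply: (Ck_onS (fun=> snd)) => // [p _|v]; first exact: is_diff_snd.
    exact: Ck_on_cst.
  have Afst : A `<=` fst @^-1` chart_img i by move=> p [].
  apply: Ck_onD => //; last exact: (Ck_on_one_form b i fst snd is_diff_fst).
  apply: Ck_on_sqrt => //;
    last exact: (Ck_on_metric a i fst snd snd is_diff_fst).
  by move=> p [pi p0]; rewrite rm_pos// of_coord_eq0.
- by move=> x y; exact: randers_gt0.
- move=> x t y t0; rewrite /F one_formZ /rnorm rmZl rmZr mulrA -expr2 mulrDr.
  by rewrite sqrtrM ?sqr_ge0// sqrtr_sqr gtr0_norm.
- move=> x y v y0 v0; rewrite randers_fundamental_tensor//.
  have ayy := rm_pos a y0.
  have r0 : 0 < rnorm a y by rewrite sqrtr_gt0.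
  have Fr : 0 < F x y / rnorm a y by rewrite divr_gt0// randers_gt0.
  have [cs csE] := rm_ge0_orthogonal x y v y0.
  (* If [v] is not parallel to [y], the orthogonal part makes the second term positive. *)
  have [vy|vy] := eqVneq v ((a x y v / a x y y) *: y); last first.
    by rewrite ltr_wpDl ?sqr_ge0// mulr_gt0// lt_neqAle cs csE vy.
  apply: ltr_pwDl; last by rewrite mulr_ge0// ltW.
  (* Now v = t y, and the first term becomes (t F(y))^2, with t nonzero because [v] is. *)
  set t := _ / _ in vy; rewrite vy rmZr one_formZ -mulrA.
  have -> : a x y y / rnorm a y = rnorm a y.
    rewrite -[a x y y]sqr_sqrtr ?(ltW ayy)// expr2 mulfK//.
    by rewrite gt_eqF.
  rewrite -mulrDr -[_ + _]/(F x y) exprn_even_gt0//=.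
  apply: mulf_neq0; last by rewrite gt_eqF ?randers_gt0.
  by apply: contra_neq v0 => t0; rewrite vy t0 scale0r.
Qed.

End RandersMetrics.

(** * The dual norm of a 1-form through its representing vector *)

Section DualNorm.
Context {R : realType} {n : nat} {M : smooth_manifold R n}.
Variables (a : riemannian_metric M) (b : one_form M).

Let gram (x : M) : 'M[R]_n :=
  \matrix_(i, j) a x ('e_i : tangent x) ('e_j : tangent x).

Lemma mulmx_gram (x : M) (v : tangent x) j :
  ((v : 'rV_n) *m gram x) 0 j = a x v ('e_j : tangent x).
Proof.
rewrite [in RHS](row_sum_delta v) rm_suml mxE.
by apply: eq_bigr => i _; rewrite rmZl mxE.
Qed.

(** A row vector [v] killed by the Gram matrix has a(v, v) = 0, hence vanishes by positivity. *)
Lemma gram_unit (x : M) : gram x \in unitmx.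
Proof.
rewrite -row_free_unit; apply: inj_row_free => v vA.
apply/eqP/negP => /negP /(@rm_pos _ _ _ a x).
suff -> : a x v v = 0 by rewrite ltxx.
rewrite {1}(row_sum_delta v) rm_suml big1// => j _.
by rewrite rmZl rmC -mulmx_gram vA mxE mulr0.
Qed.

(** With A the Gram matrix, the row of the b(e_j) is B A, so contracting it with the inverse of A
    returns the components of B; what remains is the sum of the B_j b(e_j), that is b(B) = a(B,
    B). *)
Lemma dual_norm_sqE (x : M) (B : tangent x) :
  (forall y, b x y = a x B y) -> dual_norm_sq a b x = a x B B.
Proof.
move=> bE; rewrite /dual_norm_sq -/(gram x) exchange_big /=.
rewrite {1}(row_sum_delta B) rm_suml; apply: eq_bigr => j _.
rewrite rmZl -mulr_suml (rmC _ _ 'e_j) -bE; congr (_ * _).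
rewrite -[in RHS](mulmxK (gram_unit x) B) mxE.
by apply: eq_bigr => i _; rewrite mulmx_gram bE mulrC.
Qed.

(** Cauchy-Schwarz against the representing vector; it supplies the pointwise bound assumed for
    Randers metrics above. *)
Lemma one_form_lt_of_dual (x : M) (B : tangent x) :
  (forall y, b x y = a x B y) -> a x B B < 1 ->
  forall y : tangent x, y != 0 -> b x y ^+ 2 < a x y y.
Proof.
move=> bE B1 y y0; rewrite bE; apply: le_lt_trans (cauchy_schwarz a x B y) _.
by rewrite gtr_pMl// rm_pos.
Qed.

End DualNorm.

(** * Indicatrices, uniqueness of solutions and composition of winds *)

Section Indicatrices.
Context {R : realType} {n : nat} {M : smooth_manifold R n}.
Implicit Types F G : forall x : M, tangent x -> R.

Lemma finsler0 F (x : M) : is_finsler F -> F x 0 = 0.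
Proof.
(* Homogeneity with factor 2 gives F(0) = 2 F(0). *)
move=> fF; have := finsler_homogeneous fF (0 : tangent x) (ltr0Sn R 1).
by rewrite scaler0 => F2; lra.
Qed.

(** For nonzero y, the vector y / F(y) lies on the indicatrix of F, hence on that of G, and
    homogeneity of G gives G(y) = F(y). *)
Lemma finsler_indicatrix_inj F G : is_finsler F -> is_finsler G ->
  (forall x : M, indicatrix F x = indicatrix G x) -> F = G.
Proof.
move=> fF fG FG; apply: functional_extensionality_dep => x.
apply/funext => y; have [->|y0] := eqVneq y 0; first by rewrite !finsler0.
have Fy := finsler_pos fF y0.
have : indicatrix F x ((F x y)^-1 *: y).
  by rewrite /indicatrix /= finsler_homogeneous ?invr_gt0// mulVf ?gt_eqF.
rewrite FG /indicatrix /= finsler_homogeneous ?invr_gt0//.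
by move=> /(canRL (mulVKf _)) ->; rewrite ?mulr1 ?gt_eqF.
Qed.

Lemma zermelo_solution_unique G F (U : forall x : M, tangent x)
    (H : forall x : M, tangent x -> R) :
  zermelo_solution G U F -> zermelo_solution G U H <-> H = F.
Proof.
move=> sF; split=> [[fH iH]|->//]; case: sF => fF iF.
by apply: finsler_indicatrix_inj => // x; rewrite iH iF.
Qed.

(** The data metric enters a navigation problem only through its indicatrix. That of [F] is the one
    of [G] moved by [U], and a further move by [V] amounts to one move by [U + V]. *)
Lemma zermelo_solution_comp G F (U V : forall x : M, tangent x)
    (H : forall x : M, tangent x -> R) :
  zermelo_solution G U F ->
  zermelo_solution F V H <-> zermelo_solution G (fun x => U x + V x) H.
Proof.
move=> [_ iF]; suff E x : [set z + V x | z in indicatrix F x] =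
    [set z + (U x + V x) | z in indicatrix G x].
  by split=> -[fH iH]; split=> // x; rewrite iH E.
rewrite iF image_comp; apply: eq_imagel => z _ /=; exact: esym (addrA _ _ _).
Qed.

End Indicatrices.

(** * Explicit Randers solution for a Riemannian metric and one wind *)

Section Navigation.
Context {R : realType} {n : nat} {M : smooth_manifold R n}.

Lemma vector_field_add_smooth (V W : vector_field M) (i : atlas M) :
  smooth_on (chart_img i)
    (fun u => to_coord (V (chart_inv i u) + W (chart_inv i u))).
Proof.
move=> k; apply: (Ck_on_ext
  (fun u => to_coord (V (chart_inv i u)) + to_coord (W (chart_inv i u)))) => //.
- exact: open_chart_img.
- by move=> u _; rewrite /to_coord linearD.
- by apply: Ck_onD; [exact: open_chart_img|exact: vf_smooth|exact: vf_smooth].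
Qed.

(** Bundles V + W with its smoothness, so that the explicit solution can be formed for this wind. *)
Definition vector_field_add (V W : vector_field M) : vector_field M :=
  @VectorField _ _ _ (fun x => V x + W x) (vector_field_add_smooth V W).

Variables (h : riemannian_metric M) (U : vector_field M).
Hypothesis U1 : forall x : M, rnorm h (U x) < 1.

Let lam (x : M) : R := 1 - h x (U x) (U x).

Lemma nav_lam_gt0 (x : M) : 0 < lam x.
Proof.
by have := U1 x; rewrite /rnorm -[X in _ < X]sqrtr1 ltr_sqrt// subr_gt0.
Qed.

Lemma nav_lam_neq0 (x : M) : lam x != 0.
Proof. exact/lt0r_neq0/nav_lam_gt0. Qed.

Lemma Ck_on_wind (i : atlas M) (w : 'rV[R]_n) (k : nat) :
  Ck_on k (chart_img i)
    (fun u => h _ (U (chart_inv i u)) (of_coord i u w) : R^o).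
Proof.
(* Smoothness of [U] is a statement about its components, so [U] is written as the vector with these
   components. *)
apply: (Ck_on_ext (fun u => h _ (of_coord i u (to_coord (U (chart_inv i u))))
    (of_coord i u w))); first exact: open_chart_img.
  by move=> u ui; rewrite to_coordK.
apply: (Ck_on_metric h i id) => //; first exact: open_chart_img.
  exact: vf_smooth.
exact/Ck_on_cst/open_chart_img.
Qed.

Lemma Ck_on_nav_lam (i : atlas M) (k : nat) :
  Ck_on k (chart_img i) (fun u => lam (chart_inv i u) : R^o).
Proof.
have oi := open_chart_img i.
apply: Ck_onD => //; first exact: Ck_on_cst.
apply: Ck_onN => //; apply: (Ck_on_ext (fun u =>
    h _ (of_coord i u (to_coord (U (chart_inv i u))))
      (of_coord i u (to_coord (U (chart_inv i u)))))) => //.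
  by move=> u ui; rewrite to_coordK.
by apply: (Ck_on_metric h i id) => //; exact: vf_smooth.
Qed.

(** Division by lam^2 is written as a product of inverses to match the rules [Ck_onM] and
    [Ck_onV]. *)
Let alpha (x : M) (v w : tangent x) : R :=
  (lam x * h x v w + h x (U x) v * h x (U x) w) * ((lam x)^-1 * (lam x)^-1).

Let beta (x : M) (v : tangent x) : R := - h x (U x) v * (lam x)^-1.

Lemma nav_alpha_linear (x : M) (w : tangent x) : scalar ((@alpha x)^~ w).
Proof.
by move=> c v v'; rewrite /alpha !(rmDl, rmDr) !(rmZl, rmZr); ring.
Qed.

Lemma nav_alpha_sym (x : M) (v w : tangent x) : alpha x v w = alpha x w v.
Proof. by rewrite /alpha rmC; ring. Qed.

Lemma nav_alpha_pos (x : M) (v : tangent x) : v != 0 -> 0 < alpha x v v.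
Proof.
move=> v0; rewrite /alpha mulr_gt0 ?mulr_gt0 ?invr_gt0 ?nav_lam_gt0//.
apply: ltr_pwDl; first by rewrite mulr_gt0 ?rm_pos ?nav_lam_gt0.
by rewrite -expr2 sqr_ge0.
Qed.

Lemma nav_alpha_smooth (i : atlas M) (w w' : 'rV[R]_n) : smooth_on (chart_img i)
  (fun u => alpha _ (of_coord i u w) (of_coord i u w') : R^o).
Proof.
move=> k; have oi := open_chart_img i; have lk := Ck_on_nav_lam i k.
have lVk := Ck_onV oi (fun u _ => nav_lam_neq0 _) lk.
apply: (Ck_onM oi _ (Ck_onM oi lVk lVk)).
apply: (Ck_onD oi (Ck_onM oi lk (rm_smooth _ _ _ _ _))).
by apply: Ck_onM => //; exact: Ck_on_wind.
Qed.

Lemma nav_beta_linear (x : M) : scalar (@beta x).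
Proof. by move=> c v v'; rewrite /beta rmDr rmZr; ring. Qed.

Lemma nav_beta_smooth (i : atlas M) (w : 'rV[R]_n) :
  smooth_on (chart_img i) (fun u => beta _ (of_coord i u w) : R^o).
Proof.
move=> k; have oi := open_chart_img i; have lk := Ck_on_nav_lam i k.
have lVk := Ck_onV oi (fun u _ => nav_lam_neq0 _) lk.
by apply: (Ck_onM oi _ lVk); apply: Ck_onN => //; exact: Ck_on_wind.
Qed.

Definition nav_alpha : riemannian_metric M :=
  @RiemannianMetric _ _ _ alpha nav_alpha_linear nav_alpha_sym nav_alpha_pos
    nav_alpha_smooth.

Definition nav_beta : one_form M :=
  @OneForm _ _ _ beta nav_beta_linear nav_beta_smooth.

Definition nav_metric (x : M) (y : tangent x) : R :=
  rnorm nav_alpha y + nav_beta x y.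

(* [- lam U] is the vector dual to [nav_beta], and its norm for [nav_alpha] is
   the norm of [U] for [h]. *)
Lemma nav_betaE (x : M) (y : tangent x) :
  nav_beta x y = nav_alpha x (- lam x *: U x) y.
Proof.
rewrite /= /alpha /beta rmZl rmZr -[h x (U x) (U x)](subKr 1) -/(lam x); field.
exact: nav_lam_neq0.
Qed.

Lemma nav_beta_dual_norm (x : M) :
  nav_alpha x (- lam x *: U x) (- lam x *: U x) = h x (U x) (U x).
Proof.
rewrite -nav_betaE /= /beta rmZr; field; exact: nav_lam_neq0.
Qed.

(** The representing vector has squared norm h(U, U) < 1, which yields both the Finsler property and
    the bound on the dual norm. *)
Lemma nav_metric_randers : is_randers nav_metric.
Proof.
have b1 x : nav_alpha x (- lam x *: U x) (- lam x *: U x) < 1.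
  by rewrite nav_beta_dual_norm -subr_gt0 nav_lam_gt0.
split.
  apply: randers_finsler => x.
  exact: one_form_lt_of_dual (@nav_betaE x) (b1 x).
exists nav_alpha, nav_beta; split=> // x.
by rewrite (dual_norm_sqE _ _ _ _ (@nav_betaE x)).
Qed.

(** With q = h(y, y) and u = h(U, y), the left side says sqrt(lam q + u^2) = lam + u and the right
    side says q = lam + 2u; squaring the former gives the latter. *)
Lemma nav_metric_eq1 (x : M) (y : tangent x) :
  nav_metric x y = 1 <-> h x (y - U x) (y - U x) = 1.
Proof.
have l0 := nav_lam_gt0 x.
have -> : h x (y - U x) (y - U x) = h x y y - 2 * h x (U x) y + 1 - lam x.
  by rewrite -scaleN1r !(rmDl, rmDr) !(rmZl, rmZr) (rmC _ _ y) /lam; ring.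
rewrite /nav_metric /rnorm /= /alpha /beta.
set q := h x y y; set u := h x (U x) y; set l := lam x in l0 *.
have q0 : 0 <= q by exact: rm_ge0.
have s0 : 0 <= l * q + u * u.
  by apply: addr_ge0; [exact: mulr_ge0 (ltW l0) q0|rewrite -expr2 sqr_ge0].
rewrite sqrtrM// -(expr2 l^-1) sqrtr_sqr gtr0_norm ?invr_gt0//.
rewrite -mulrDl; split.
  move=> /(canRL (mulfVK _)); rewrite mul1r => /(_ (lt0r_neq0 l0)).
  move=> /(canRL (addrK _)); rewrite opprK => su.
  have : l * q + u * u = (l + u) ^+ 2.
    by rewrite -su sqr_sqrtr.
  move=> E; have : l * (q - 2 * u - l) = 0 by move: E; rewrite expr2 => E; lra.
  by move=> /eqP; rewrite mulf_eq0 gt_eqF//= => /eqP; lra.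
move=> qE; have -> : l * q + u * u = (l + u) ^+ 2.
  have -> : q = l + 2 * u by lra.
  by ring.
(* The root is lam + u and not its opposite: 2 (lam + u) = lam + q is positive because q >= 0. *)
rewrite sqrtr_sqr ger0_norm; last by lra.
by rewrite addrK mulfV// gt_eqF.
Qed.

Lemma nav_metric_zermelo : zermelo_solution (@rnorm R n M h) U nav_metric.
Proof.
split=> [|x]; first by have [] := nav_metric_randers.
have r1 z : rnorm h z = 1 <-> h x z z = 1.
  split=> [z1|z1]; last by rewrite /rnorm z1 sqrtr1.
  by rewrite -[LHS]sqr_sqrtr ?rm_ge0// -/(rnorm h z) z1 expr1n.
apply/seteqP; split=> y /=.
  by move=> /nav_metric_eq1/r1 y1; exists (y - U x); rewrite ?subrK.
by move=> [z /r1 z1 <-]; apply/nav_metric_eq1; rewrite addrK.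
Qed.

End Navigation.

Theorem theorem2p5 (R : realType) (n : nat) (M : smooth_manifold R n)
    (h : riemannian_metric M) (V W : vector_field M)
    (F1 : forall x : M, tangent x -> R)
    (hV : forall x : M, rnorm h (V x) < 1)
    (hF1 : zermelo_solution (@rnorm R n M h) V F1)
    (hI : forall x : M, rnorm h (V x + W x) < 1)
    (hII : forall x : M, F1 x (- W x) < 1) :
  exists F : forall x : M, tangent x -> R,
    is_randers F /\
    (forall G : forall x : M, tangent x -> R,
       zermelo_solution (@rnorm R n M h) (fun x => V x + W x) G <-> G = F) /\
    (forall G : forall x : M, tangent x -> R,
       zermelo_solution F1 W G <-> G = F).
Proof.
have sF := nav_metric_zermelo h (vector_field_add V W) hI.
exists (nav_metric h (vector_field_add V W) hI); split.
  exact: nav_metric_randers.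
have uF G := zermelo_solution_unique _ _ _ G sF.
(* By [hF1], wind [W] on [F1] amounts to wind V + W on [h], so (II) becomes (I). *)
by split=> // G; rewrite (zermelo_solution_comp _ _ _ _ _ hF1); exact: uF.
Qed.
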